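(* Let $M$ be a compact length space. Every closed geodesic in $M$ is a $1/k$ geodesic for some sufficiently large $k\in\mathbb{N}$. Consequently $$\bigcup_{k=1}^{\infty}L_{1/k}(M)=L(M).$$
   Context: A compact length space is a compact metric space in which every pair of points is joined by a rectifiable curve whose length equals the distance between the points. $S^1=\mathbb{R}/2\pi\mathbb{Z}$. A closed geodesic in $M$ is a nonconstant map $\gamma:S^1\to M$ that is locally length minimizing around every point of $S^1$, parametrized proportionally to arclength with speed $L(\gamma)/(2\pi)$, where $L(\gamma)$ is its length. The length spectrum $L(M)$ is the set of lengths of closed geodesics in $M$. A $1/k$ geodesic is a closed geodesic $\gamma$ with $d(\gamma(t),\gamma(t+2\pi/k))=L(\gamma)/k$ for all $t\in S^1$. $L_{1/k}(M)$ is the set of lengths of $1/k$ geodesics in $M$. *)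

(* Defs.v *)
From HB Require Import structures.
From mathcomp Require Import all_boot all_order all_algebra.
From mathcomp Require Import all_classical all_reals all_analysis.

Set Implicit Arguments.
Unset Strict Implicit.
Unset Printing Implicit Defensive.

Import Order.TTheory GRing.Theory Num.Theory.
Import numFieldNormedType.Exports.

Local Open Scope classical_set_scope.
Local Open Scope ring_scope.

Section LengthSpaces.
Context {R : realType} {M : metricType R}.
Implicit Types (c g : R -> M) (a b : R) (x y : M).

(* As [variation] in numfun, with the distance of M in place of `|_ - _|.
   A partition s of [a, b] lists its points after a, hence [a :: s]. *)
Definition polygonal_length a b c (s : seq R) : R :=
  let F := c \o nth b (a :: s) in
  \sum_(0 <= i < size s) mdist (F i) (F i.+1).

(* Meaningful for a <= b only: there is no partition otherwise. *)
Definition curve_length a b c : \bar R :=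
  ereal_sup [set (polygonal_length a b c s)%:E | s in itv_partition a b].

Definition joins a b c x y : Prop :=
  [/\ a <= b, {within `[a, b], continuous c}, c a = x & c b = y].

Definition rectifiable a b c : Prop := (curve_length a b c < +oo)%E.

Definition length_minimizing a b c : Prop :=
  forall a' b' c', joins a' b' c' (c a) (c b) ->
    (curve_length a b c <= curve_length a' b' c')%E.

(* Maps on S^1 = R / 2 pi Z are represented by 2 pi-periodic maps on R; the
   arc of S^1 from s to t (s <= t) is the image of [s, t]. *)
Definition circle_map g : Prop := forall t, g (t + 2 * pi) = g t.

(* A real number; it is the length of g when g is rectifiable, which is part
   of [closed_geodesic]. *)
Definition closed_length g : R := fine (curve_length 0 (2 * pi) g).

Record closed_geodesic g : Prop := ClosedGeodesic {
  closed_geodesic_circle : circle_map g;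
  closed_geodesic_continuous : continuous g;
  closed_geodesic_nonconstant : exists s t, g s <> g t;
  closed_geodesic_rectifiable : rectifiable 0 (2 * pi) g;
  closed_geodesic_locally_minimizing : forall t,
    exists2 e : R, 0 < e & length_minimizing (t - e) (t + e) g;
  closed_geodesic_speed : forall s t, s <= t ->
    curve_length s t g = (closed_length g / (2 * pi) * (t - s))%:E
}.

(* 0 < k is needed: for k = 0 the equation holds trivially, as x / 0 = 0. *)
Definition inv_geodesic (k : nat) g : Prop :=
  [/\ (0 < k)%N, closed_geodesic g &
    forall t, mdist (g t) (g (t + 2 * pi / k%:R)) = closed_length g / k%:R].

End LengthSpaces.

Section LengthSpectra.
Context {R : realType}.
Variable M : metricType R.

Definition compact_length_space : Prop :=
  compact [set: M] /\
  forall x y : M, exists a b (c : R -> M),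
    [/\ joins a b c x y, rectifiable a b c &
        curve_length a b c = (mdist x y)%:E].

Definition length_spectrum : set R :=
  [set closed_length g | g in [set g : R -> M | closed_geodesic g]].

Definition inv_length_spectrum (k : nat) : set R :=
  [set closed_length g | g in [set g : R -> M | inv_geodesic k g]].

End LengthSpectra.

(* Main.v *)
Require Import Defs.
From mathcomp Require Import all_boot all_order all_algebra.
From mathcomp Require Import all_classical all_reals all_analysis.
From mathcomp Require Import lra.

(** A closed geodesic minimizes length on a neighbourhood of every parameter.
    In a length space the endpoints of such a neighbourhood are joined by a
    curve as short as their distance, so the geodesic realizes the distance
    between them, and by the triangle inequality also between any two of its
    points in that neighbourhood ([mdist_minimizing_speed]).  By compactness
    of a period, the chord condition of a 1/k geodesic then holds at every
    parameter of the period at once, as soon as [2 * pi / k] is small enough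
    ([near_chord_period]); periodicity extends it to the whole line.  The
    equality of spectra follows, as a 1/k geodesic is by definition a closed
    geodesic. *)

Set Implicit Arguments.
Unset Strict Implicit.
Unset Printing Implicit Defensive.

Import Order.TTheory GRing.Theory Num.Theory.
Import numFieldNormedType.Exports.

Local Open Scope classical_set_scope.
Local Open Scope ring_scope.

Section ClosedGeodesics.
Context {R : realType} {M : metricType R}.
Implicit Types (c g : R -> M) (a b s t : R).

Lemma mdist_le_curve_length a b c : a < b ->
  ((mdist (c a) (c b))%:E <= curve_length a b c)%E.
Proof.
move=> ab; apply: ereal_sup_ubound; exists [:: b]; first exact: itv_partition1.
by rewrite /polygonal_length /= big_nat1.
Qed.

(** The shortest curve that a length space provides between the endpoints is
    one of the competitors of [c]. *)
Lemma length_minimizing_mdist a b c : compact_length_space M ->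
  length_minimizing a b c ->
  (curve_length a b c <= (mdist (c a) (c b))%:E)%E.
Proof.
move=> [_ /(_ (c a) (c b)) [a' [b' [c' [jc' _ <-]]]]].
by move=> /(_ _ _ _ jc').
Qed.

(** The chord from [g s] to [g t] cannot be shorter than the arc, for otherwise
    the triangle inequality through it would bring the endpoints [g a] and
    [g b] closer than the length of the whole arc. *)
Lemma mdist_minimizing_speed v a b g s t : compact_length_space M ->
  (forall x y, x <= y -> curve_length x y g = (v * (y - x))%:E) ->
  length_minimizing a b g -> a <= s -> s <= t -> t <= b ->
  mdist (g s) (g t) = v * (t - s).
Proof.
move=> hM speed gmin as_ st tb.
have le_speed x y : x <= y -> mdist (g x) (g y) <= v * (y - x).
  rewrite le_eqVlt => /predU1P[->|xy]; first by rewrite mdistxx subrr mulr0.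
  by rewrite -lee_fin -speed ?(ltW xy)// mdist_le_curve_length.
have ab : a <= b by rewrite (le_trans as_)// (le_trans st).
have := length_minimizing_mdist hM gmin; rewrite speed// lee_fin => gab.
have tri1 := metric_triangle (g a) (g s) (g b).
have tri2 := metric_triangle (g s) (g t) (g b).
have := le_speed _ _ as_; have := le_speed _ _ st; have := le_speed _ _ tb.
by move=> *; apply/eqP; rewrite eq_le; apply/andP; split; lra.
Qed.

Lemma circle_map_intmul g (n : int) t : circle_map g ->
  g (t + (2 * pi) *~ n) = g t.
Proof.
move=> gper.
have gnat (m : nat) u : g (u + (2 * pi) *+ m) = g u.
  by elim: m u => [|m IH] u; rewrite ?addr0// mulrSr addrA gper.
case: n => n; first exact: gnat.
by rewrite NegzE mulrNz -(gnat n.+1 (t - _)) -pmulrn subrK.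
Qed.

(** A minimizing neighbourhood of radius [e] around [x] contains every arc
    that starts within [e / 2] of [x] and has parameter length at most [e / 2],
    so that one threshold for [k] serves all parameters near [x]; compactness
    of a period then gives one threshold for all of its parameters. *)
Lemma near_chord_period g : compact_length_space M -> closed_geodesic g ->
  \forall k \near \oo, `[0, 2 * pi] `<=`
    [set t | mdist (g t) (g (t + 2 * pi / k%:R)) = closed_length g / k%:R].
Proof.
move=> hM [_ _ _ _ gmin speed].
have /compact_near_coveringP covering := @segment_compact R 0 (2 * pi).
apply: (covering nat \oo (fun k t =>
  mdist (g t) (g (t + 2 * pi / k%:R)) = closed_length g / k%:R)) => x _.
have [e e0 mine] := gmin x.
have pi0 : 0 < (pi : R) := pi_gt0 R.
have e20 : 0 < e / 2 by rewrite divr_gt0.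
near=> s k.
have : `|x - s| < e / 2 by near: s; exact: cvgr_dist_lt.
rewrite ltr_distl => /andP[_s s_].
have k0 : 0 < k%:R :> R by near: k; exact: nbhs_infty_gtr.
have step_ge0 : 0 <= 2 * pi / k%:R :> R by rewrite divr_ge0// ?mulr_ge0 ?ltW.
have step_le : 2 * pi / k%:R <= e / 2.
  rewrite ler_pdivrMr// [leRHS]mulrC -ler_pdivrMr//.
  by near: k; exact: nbhs_infty_ger.
rewrite (mdist_minimizing_speed hM speed mine) /=; first 1 last.
- by lra.
- by rewrite lerDl.
- by lra.
by rewrite addrAC subrr add0r mulrA divfK // mulf_neq0 // gt_eqF.
Unshelve. all: by end_near. Qed.

Lemma closed_geodesic_near_inv g : compact_length_space M ->
  closed_geodesic g -> \forall k \near \oo, inv_geodesic k g.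
Proof.
move=> hM gg; near=> k; split=> //; first by near: k; exact: nbhs_infty_gt.
have chord : `[0, 2 * pi] `<=`
    [set t | mdist (g t) (g (t + 2 * pi / k%:R)) = closed_length g / k%:R].
  by near: k; exact: near_chord_period.
have per := circle_map_intmul _ _ (closed_geodesic_circle gg).
have T0 : 0 < 2 * pi :> R by rewrite mulr_gt0// pi_gt0.
move=> t; set n := Num.floor (t / (2 * pi)).
have := floor_itv (t / (2 * pi)).
rewrite -/n ler_pdivlMr// ltr_pdivrMr// !mulrzl mulrzDr mulr1z.
move=> /andP[nt /ltW tn].
have : mdist (g (t - (2 * pi) *~ n)) (g (t - (2 * pi) *~ n + 2 * pi / k%:R))
    = closed_length g / k%:R.
  by apply: chord; rewrite /= in_itv/= subr_ge0 nt lerBlDl.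
rewrite -(per n (t - _ + 2 * pi / _)) -(per n (t - _)).
by rewrite (addrAC _ (2 * pi / _)) !subrK.
Unshelve. all: by end_near. Qed.

End ClosedGeodesics.

Theorem theorem3p1 (R : realType) (M : metricType R)
    (hM : compact_length_space M) :
  (forall g : R -> M, closed_geodesic g ->
     exists k0 : nat, forall k : nat, (k0 <= k)%N -> inv_geodesic k g) /\
  \bigcup_(k in [set k : nat | (1 <= k)%N]) inv_length_spectrum M k
    = length_spectrum M.
Proof.
have eventually_inv (g : R -> M) : closed_geodesic g ->
    exists k0 : nat, forall k : nat, (k0 <= k)%N -> inv_geodesic k g.
  by move=> /(closed_geodesic_near_inv hM)[k0 _ hk0]; exists k0.
split=> //; apply/seteqP; split=> [_ [k _ [g [_ gg _] <-]]|_ [g gg <-]].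
  by exists g.
have [k0 hk0] := eventually_inv g gg.
by exists k0.+1 => //; exists g => //; apply: hk0.
Qed.
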